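(* Let $n\ge 1$. For every Boolean function $f:\{0,1\}^n\to\{0,1\}$ there is a hypergraph $G$ on the vertex set $\{1,\dots,n\}$ whose $n$-qubit hypergraph state is $$|G\rangle=\frac{1}{\sqrt{2^n}}\sum_{i\in[2^n]}(-1)^{f(\mathrm{bin}(i))}\,|\mathrm{bin}(i)\rangle .$$
   Context: $[2^n]=\{0,1,\dots,2^n-1\}$, and $\mathrm{bin}(i)=(i_1,\dots,i_n)\in\{0,1\}^n$ is the $n$-term binary representation of $i\in[2^n]$ (most significant digit first). $|0\rangle,|1\rangle$ is the standard basis of $\mathcal H_2=\mathbb C^2$, $|\mathrm{bin}(i)\rangle=|i_1\rangle\otimes\cdots\otimes|i_n\rangle$, and $\{|\mathrm{bin}(i)\rangle: i\in[2^n]\}$ is the computational basis of $\mathcal H_2^{\otimes n}$. A hypergraph $G=(V(G),E(G))$ has vertex set $V(G)=\{1,\dots,n\}$ and a set $E(G)$ of hyperedges, each a subset of $V(G)$ (the empty subset is allowed). For $e\subseteq V(G)$, the controlled-$Z$ operator $Z_e$ on $\mathcal H_2^{\otimes n}$ is the linear operator with $Z_e|\mathrm{bin}(i)\rangle=-|\mathrm{bin}(i)\rangle$ if $i_v=1$ for all $v\in e$, and $Z_e|\mathrm{bin}(i)\rangle=|\mathrm{bin}(i)\rangle$ otherwise. With $|+\rangle=\frac1{\sqrt2}(|0\rangle+|1\rangle)$, the hypergraph state of $G$ is $|G\rangle=\left(\prod_{e\in E(G)}Z_e\right)|+\rangle^{\otimes n}$. *)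

(* Defs.v *)
From mathcomp Require Import all_boot all_order all_algebra.
From mathcomp Require Import reals.
From mathcomp Require Export complex mxtens.

Set Implicit Arguments.
Unset Strict Implicit.
Unset Printing Implicit Defensive.

Import GRing.Theory Num.Theory.
Local Open Scope ring_scope.

(* The vertices 1, ..., n are encoded as the elements 0, ..., n - 1 of 'I_n.  *)
Definition hypergraph (n : nat) := {set {set 'I_n}}.

(* Digit v has weight 2 ^ (n - 1 - v): most significant digit first.          *)
Definition bin (n : nat) (i : 'I_(2 ^ n)) : n.-tuple bool :=
  [tuple odd (i %/ 2 ^ (n - v.+1)) | v < n].

Section Qubits.
Variable C : numClosedFieldType.

Definition ket (b : bool) : 'cV[C]_2 := delta_mx (inord b) 0.

Definition ket_plus : 'cV[C]_2 := (sqrtC 2)^-1 *: (ket false + ket true).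

(* v 0 (x) v 1 (x) ... (x) v (n - 1), where (C^2)^{(x) n} is 'cV_(2 ^ n).     *)
Fixpoint tensor (n : nat) : ('I_n -> 'cV[C]_2) -> 'cV[C]_(2 ^ n) :=
  match n return ('I_n -> 'cV[C]_2) -> 'cV[C]_(2 ^ n) with
  | 0 => fun=> 1%:M
  | m.+1 => fun v => castmx (esym (expnS 2 m), muln1 1)
                       (v ord0 *t tensor (fun j => v (lift ord0 j)))
  end.

Definition ket_bin (n : nat) (i : 'I_(2 ^ n)) : 'cV[C]_(2 ^ n) :=
  tensor (fun v => ket (tnth (bin i) v)).

(* Operators are matrices acting on column vectors by left multiplication.    *)
(* CZ e is the sum of +/- |bin(i)><bin(i)|; the transpose is the adjoint here *)
(* because |bin(i)> has real entries. Lemma CZ_ket_bin below shows that this  *)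
(* is the linear operator prescribed on the computational basis.              *)
Definition CZ (n : nat) (e : {set 'I_n}) : 'M[C]_(2 ^ n) :=
  \sum_(i < 2 ^ n)
     (if [forall v in e, tnth (bin i) v] then -1 else 1)
       *: (ket_bin i *m (ket_bin i)^T).

Definition hypergraph_state (n : nat) (G : hypergraph n) : 'cV[C]_(2 ^ n) :=
  (\prod_(e in G) CZ e) *m tensor (fun _ : 'I_n => ket_plus).

Lemma ket_binE (n : nat) (i : 'I_(2 ^ n)) : ket_bin i = delta_mx i 0.
Proof.
rewrite /ket_bin; elim: n i => [|n IHn] i.
  by apply/matrixP => a b; move: (i : 'I_1) => i0; rewrite !mxE !ord1 !eqxx.
have lt_r : (i %% 2 ^ n < 2 ^ n)%N by rewrite ltn_mod expn_gt0.
have lt_q : (i %/ 2 ^ n < 2)%N by rewrite ltn_divLR ?expn_gt0 // -expnS.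
have tail : tensor (fun j => ket (tnth (bin i) (lift ord0 j)))
          = delta_mx (Ordinal lt_r) 0.
  rewrite -IHn; congr (tensor _); apply: boolp.funext => j.
  congr (ket _); rewrite !tnth_mktuple /= /bump /= add1n subSS.
  have E : (2 ^ n = 2 ^ j.+1 * 2 ^ (n - j.+1))%N by rewrite -expnD subnKC.
  rewrite [in LHS](divn_eq i (2 ^ n)) {2}E mulnA divnMDl ?expn_gt0 //.
  by rewrite oddD oddM oddX andbF.
rewrite /= tail tnth_mktuple subSS subn0.
apply/matrixP => a b; rewrite castmxE !mxE /= !ord1 /= !eqxx !andbT.
rewrite -natrM mulnb; congr ((nat_of_bool _)%:R).
rewrite -!val_eqE /= inordK; last by case: (odd _).
have -> : odd (i %/ 2 ^ n) = (i %/ 2 ^ n)%N :> nat.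
  by case: (i %/ 2 ^ n)%N lt_q => [|[|]].
apply/andP/eqP => [[/eqP Eq /eqP Er]|-> //].
by rewrite (divn_eq a (2 ^ n)) Eq Er -divn_eq.
Qed.

Lemma CZ_ket_bin (n : nat) (e : {set 'I_n}) (i : 'I_(2 ^ n)) :
  CZ e *m ket_bin i =
  if [forall v in e, tnth (bin i) v] then - ket_bin i else ket_bin i.
Proof.
rewrite mulmx_suml (bigD1 i) //= big1 ?addr0 => [|k neq_ki].
  rewrite -scalemxAl -mulmxA !ket_binE trmx_delta mul_delta_mx.
  by rewrite mul_delta_mx; case: ifP; rewrite ?scaleN1r ?scale1r.
rewrite -scalemxAl -mulmxA !ket_binE trmx_delta mul_delta_mx_0 //.
by rewrite mulmx0 scaler0.
Qed.

End Qubits.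

Arguments ket_bin {C n} i.
Arguments CZ {C n} e.

(* Main.v *)
Require Import Defs.
From mathcomp Require Import all_boot all_order all_algebra.
From mathcomp Require Import reals complex.
Import GRing.Theory Num.Theory.
Local Open Scope ring_scope.
Local Open Scope complex_scope.

(* The operator prod_(e in G) Z_e multiplies |bin(i)> by (-1) to the number of
   hyperedges of G contained in S := {v | i_v = 1}, so f must be written as
   S |-> #{e in G | e \subset S} mod 2 for some G. The map sending G to this
   parity function is unitriangular for inclusion, hence injective, hence
   surjective, since there are as many hypergraphs as Boolean functions. *)

Definition parity_below (T : finType) (G : {set {set T}}) : {set {set T}} :=
  [set S : {set T} | odd #|[set e in G | e \subset S]|].

(** Splitting off [S] itself isolates the diagonal entry of the unitriangular map. *)
Lemma card_sub_below (T : finType) (G : {set {set T}}) (S : {set T}) :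
  #|[set e in G | e \subset S]| = ((S \in G) + #|[set e in G | e \proper S]|)%N.
Proof.
rewrite (cardsD1 S) !inE subxx andbT; congr addn.
by apply: eq_card => e; rewrite !inE properEneq andbCA.
Qed.

Lemma parity_below_inj (T : finType) : injective (@parity_below T).
Proof.
move=> G H eqGH; apply/setP => S.
(* Strong induction on the size of [S]: [G] and [H] already agree on the proper subsets of [S], so
   these contribute equal parities, which cancel. *)
have [k] := ubnP #|S|; elim: k S => // k IHk S /ltnSE leSk.
have := congr1 (fun A : {set {set T}} => S \in A) eqGH.
rewrite !inE !card_sub_below !oddD !oddb.
have -> : [set e in H | e \proper S] = [set e in G | e \proper S].
  apply/setP => e; rewrite !inE; case: (boolP (e \proper S)) => [ltes|_].
    by rewrite !andbT IHk // (leq_trans (proper_card ltes)).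
  by rewrite !andbF.
by apply: addIb.
Qed.

Lemma parity_below_surj (T : finType) (A : {set {set T}}) :
  exists G, parity_below T G = A.
Proof.
exists (invF (@parity_below_inj T) A); exact: f_invF.
Qed.

Section Amplitudes.
Variable C : numClosedFieldType.

Lemma ket_plusE : ket_plus C = const_mx (sqrtC 2)^-1.
Proof.
apply/matrixP => k j; rewrite !mxE !ord1 !eqxx !andbT -!val_eqE /= !inordK //.
by case: k => [[|[|]]] //= _; rewrite ?addr0 ?add0r mulr1.
Qed.

Lemma tensor_ket_plus (n : nat) :
  tensor (fun _ : 'I_n => ket_plus C) = const_mx ((sqrtC 2)^-1 ^+ n).
Proof.
elim: n => [|n IHn]; first by apply/matrixP => a b; rewrite !mxE !ord1.
by rewrite /= IHn ket_plusE; apply/matrixP => a b; rewrite castmxE !mxE exprS.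
Qed.

Lemma const_mx_ket_bin (n : nat) (c : C) :
  const_mx c = c *: \sum_(i < 2 ^ n) ket_bin i.
Proof.
apply/matrixP => a b; rewrite !mxE summxE (bigD1 a) //= big1 => [|i neq_ia].
  by rewrite ket_binE !mxE !ord1 !eqxx addr0 mulr1.
by rewrite ket_binE mxE eq_sym (negPf neq_ia).
Qed.

Lemma prod_CZ_ket_bin (n : nat) (G : hypergraph n) (i : 'I_(2 ^ n)) :
  (\prod_(e in G) CZ e) *m ket_bin i =
  (-1) ^+ #|[set e in G | e \subset [set v | tnth (bin i) v]]|
    *: ket_bin i :> 'cV[C]_(2 ^ n).
Proof.
(* The exponent becomes a sum over all [e] in [G] of 1 or 0, so that it can be built up edge by edge
   along with the operator product. *)
rewrite -sum1dep_card big_mkcondr /=.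
elim/big_rec2: _ => [|e k M _ IHM]; first by rewrite mul1mx scale1r.
rewrite -mulmxA IHM -scalemxAr CZ_ket_bin.
have -> : [forall v in e, tnth (bin i) v]
        = (e \subset [set v | tnth (bin i) v]).
  by apply/forall_inP/subsetP => sub v /sub; rewrite inE.
by case: ifP => // _; rewrite exprS mulN1r scaleNr scalerN.
Qed.

End Amplitudes.

Theorem lemma1 (R : realType) (n : nat) (n_ge1 : (1 <= n)%N)
    (f : n.-tuple bool -> bool) :
  exists G : hypergraph n,
    hypergraph_state R[i] G =
    (sqrtC ((2 ^ n)%N%:R : R[i]))^-1 *:
      \sum_(i < 2 ^ n) (-1) ^+ f (bin i) *: ket_bin i.
Proof.
(* A bit string is identified with its support [S], so [f] becomes a set of subsets of the
   vertices. *)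
have [G defG] := parity_below_surj _
  [set S : {set 'I_n} | f [tuple v \in S | v < n]].
exists G; rewrite /hypergraph_state tensor_ket_plus const_mx_ket_bin.
rewrite -scalemxAr natrX rootCX ?ler0n // exprVn mulmx_sumr; congr (_ *: _).
(* The sign depends only on the parity of the count, which [defG] gives at the support of
   [bin i]. *)
apply: eq_bigr => i _; rewrite prod_CZ_ket_bin -signr_odd.
have := congr1 (fun A : {set {set 'I_n}} => [set v | tnth (bin i) v] \in A) defG.
rewrite !inE => ->; congr ((-1) ^+ nat_of_bool (f _) *: _).
by apply: eq_from_tnth => v; rewrite tnth_mktuple inE.
Qed.
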